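(* Let $D=(V,A)$ be a finite simple digraph with at least one vertex. Then $\{v\}$ is a zero forcing set of $D$ for every $v\in V$ if and only if $D$ is a directed cycle.
   Context: A finite simple digraph $D=(V,A)$ has finite nonempty vertex set $V$ and arc set $A$ consisting of ordered pairs of distinct vertices (no loops, no parallel arcs; both $(u,v)$ and $(v,u)$ may be present). $N_D^+(v)=\{u:(v,u)\in A\}$. Zero forcing: for $S\subseteq V$ let $B^0(S)=S$ and $B^{i+1}(S)=B^i(S)\cup\{w:\{w\}=N_D^+(v)\setminus B^i(S)\text{ for some }v\in B^i(S)\}$. $S$ is a zero forcing set (ZFS) if $B^t(S)=V$ for some $t\ge 0$. $D$ is a directed cycle if its vertices can be labeled $v_1,\dots,v_n$ so that its arcs are exactly $(v_1,v_2),(v_2,v_3),\dots,(v_{n-1},v_n),(v_n,v_1)$, where $n\ge 2$ (for $n=2$ this is the digraph with both arcs between two vertices); by convention the digraph with a single vertex and no arcs also counts as a directed cycle. *)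

(* Defs.v *)
From mathcomp Require Import all_boot.

Set Implicit Arguments.
Unset Strict Implicit.
Unset Printing Implicit Defensive.

(* A finite simple digraph is an irreflexive arc relation on a finType; being
   a relation rules out parallel arcs, and no symmetry condition is imposed. *)

Section Digraph.

Variables (V : finType) (arc : rel V).

Definition out_nbhd (v : V) : {set V} := [set u | arc v u].

Definition zf_step (B : {set V}) : {set V} :=
  B :|: [set w | [exists v in B, out_nbhd v :\: B == [set w]]].

Definition zf_iter (t : nat) (S : {set V}) : {set V} := iter t zf_step S.

Definition zero_forcing_set (S : {set V}) : Prop :=
  exists t : nat, zf_iter t S = [set: V].

(* [ordS i] is the cyclic successor of [i] in ['I_n]. For [n = 1] it is [i]
   itself, so the arcless one-vertex cycle is a separate case. *)
Definition directed_cycle : Prop :=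
  (exists (n : nat) (l : 'I_n -> V),
     [/\ 2 <= n, bijective l &
         forall x y : V,
           arc x y <-> exists i : 'I_n, x = l i /\ y = l (ordS i)])
  \/ (#|V| = 1 /\ forall x y : V, ~~ arc x y).

End Digraph.

(* Main.v *)
(* If [set v] forces V and #|V| > 1, the very first step must force something,
   so every vertex has exactly one out-neighbour, say f v. Forcing from [set v]
   then only reaches the f-orbit of v, so every f-orbit is all of V, i.e. f is a
   single cyclic permutation. *)
Require Import Defs.
From mathcomp Require Import all_boot.

Set Implicit Arguments.
Unset Strict Implicit.
Unset Printing Implicit Defensive.

Section ZeroForcing.

Variables (V : finType) (arc : rel V).

Lemma zf_iter_mono (S : {set V}) s t :
  s <= t -> zf_iter arc s S \subset zf_iter arc t S.
Proof.
move=> /subnK <-; elim: (t - s) => [//|k IHk].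
by rewrite addSn /zf_iter iterS; apply: subset_trans IHk (subsetUl _ _).
Qed.

Lemma zf_iter_fix (S : {set V}) t : zf_step arc S = S -> zf_iter arc t S = S.
Proof. by move=> fixS; elim: t => //= t ->. Qed.

Lemma zf_step_unique_out (B : {set V}) x y :
  x \in B -> out_nbhd arc x = [set y] -> y \in zf_step arc B.
Proof.
move=> xB outx; rewrite !inE; case: (boolP (y \in B)) => //= yB.
apply/existsP; exists x; rewrite xB outx /=; apply/eqP/setP => z.
by rewrite !inE; case: eqP => [->|_]; rewrite ?andbF ?yB.
Qed.

(** Otherwise [v] forces nothing, so [[set v]] is a fixed point of [zf_step] and the iteration never
    leaves a single vertex. *)
Lemma zero_forcing_set1_out v :
  irreflexive arc -> 1 < #|V| -> zero_forcing_set arc [set v] ->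
  exists w, out_nbhd arc v = [set w].
Proof.
move=> arc_irr V_gt1 [t Bt].
(* As there are no loops, [v] can force from [[set v]] only when its whole out-neighbourhood is a
   singleton. *)
have outD : out_nbhd arc v :\: [set v] = out_nbhd arc v.
  by apply/setP => z; rewrite !inE; case: eqP => // ->; rewrite arc_irr.
have [/existsP[w /eqP] | no_out] := boolP [exists w, out_nbhd arc v == [set w]].
  by exists w.
have fixv : zf_step arc [set v] = [set v].
  apply/setP => w; rewrite !inE; apply/orb_idr => /existsP[x].
  rewrite inE => /andP[/eqP-> outv]; case/existsP: no_out.
  by exists w; rewrite -outD.
by move: V_gt1; rewrite -cardsT -Bt zf_iter_fix // cards1.
Qed.

Lemma zf_iter_orbit (f : V -> V) v t :
  (forall x, out_nbhd arc x = [set f x]) ->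
  zf_iter arc t [set v] \subset [set x | fconnect f v x].
Proof.
move=> outf; elim: t => [|t IHt]; first by rewrite sub1set inE connect0.
apply/subsetP => w; rewrite /zf_iter iterS in_setU => /orP[/(subsetP IHt)//|].
rewrite !inE => /existsP[x /andP[/(subsetP IHt)]]; rewrite inE => v_x.
rewrite outf => /eqP/setP/(_ w); rewrite !inE eqxx => /andP[_ /eqP->].
exact: connect_trans v_x (fconnect1 f x).
Qed.

Lemma fconnect_full_inj (f : V -> V) : (forall x y, fconnect f x y) -> injective f.
Proof.
move=> full; suff surj y : y \in codom f.
  apply/injectiveP/card_uniqP; rewrite size_map -cardE; apply: eq_card => y.
  by rewrite surj.
(* Starting from [f y] rather than [y] guarantees at least one application of [f] on the way back to
   [y]. Surjectivity on a finite type then gives injectivity. *)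
have /iter_findex <- := full (f y) y.
by rewrite -iterSr iterS codom_f.
Qed.

Lemma fconnect_full_directed_cycle (f : V -> V) (v0 : V) :
  1 < #|V| -> (forall x y, fconnect f x y) ->
  (forall x y, arc x y = (y == f x)) -> directed_cycle arc.
Proof.
move=> V_gt1 full arcE; have f_inj := fconnect_full_inj full.
have orderV : order f v0 = #|V| by apply: eq_card => y; apply: full.
pose l (i : 'I_#|V|) := iter i f v0.
have l_inj : injective l.
  (* Indices below the order of [v0] are recovered by [findex]. *)
  move=> i j /(congr1 (findex f v0)).
  by rewrite /l !findex_iter ?orderV // => /val_inj.
have l_bij : bijective l by apply: inj_card_bij => //; rewrite card_ord.
have lS i : l (ordS i) = f (l i).
  rewrite /l /=; have [lt_iV | ge_iV] := ltnP i.+1 #|V|.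
    by rewrite modn_small.
  (* At the last index [ordS] wraps to 0, and correspondingly [f] closes the orbit at [v0], by
     injectivity. *)
  have iS : i.+1 = #|V| by apply/eqP; rewrite eqn_leq ge_iV ltn_ord.
  by rewrite -iterS iS modnn -orderV (iter_order f_inj).
left; exists #|V|, l; split=> // x y; rewrite arcE; split.
  by case: l_bij => g _ gK /eqP->; exists (g x); rewrite lS gK.
by case=> i [-> ->]; rewrite lS.
Qed.

Lemma iter_ordS n (i : 'I_n) k : iter k (@ordS n) i = (i + k) %% n :> nat.
Proof.
elim: k => [|k IHk]; first by rewrite addn0 modn_small.
by rewrite iterS /= IHk -addn1 modnDml addn1 addnS.
Qed.

Lemma directed_cycle_zero_forcing_set1 v :
  directed_cycle arc -> zero_forcing_set arc [set v].
Proof.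
case=> [[n [l [_ [g gK lK] arcE]]]|[V1 _]]; last first.
  by exists 0; apply/eqP; rewrite eqEcard subsetT cardsT V1 cards1.
have outl i : out_nbhd arc (l i) = [set l (ordS i)].
  apply/setP => y; rewrite !inE; apply/idP/eqP => [/arcE[j [/(can_inj gK)-> ->]]|->] //.
  by apply/arcE; exists i.
have reach k : l (iter k (@ordS n) (g v)) \in zf_iter arc k [set v].
  elim: k => [|k IHk]; first by rewrite /= lK set11.
  exact: zf_step_unique_out IHk (outl _).
(* From [g v], [n - g v] steps lead around to index 0 and [g w] more lead to [w]; [n + n] bounds
   this sum for all [w] at once. *)
exists (n + n); apply/eqP; rewrite eqEsubset subsetT; apply/subsetP => w _.
have le_k : g w + (n - g v) <= n + n by rewrite leq_add ?leq_subr // ltnW.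
apply: (subsetP (zf_iter_mono _ le_k)).
suff k_w : l (iter (g w + (n - g v)) (@ordS n) (g v)) = w.
  by have := reach (g w + (n - g v)); rewrite k_w.
rewrite -[RHS]lK; congr (l _); apply: val_inj.
by rewrite /= iter_ordS addnCA subnKC 1?ltnW // modnDr modn_small.
Qed.

End ZeroForcing.

Theorem corollary2p5 (V : finType) (arc : rel V)
  (arc_irr : irreflexive arc) (V_nonempty : 0 < #|V|) :
  (forall v : V, zero_forcing_set arc [set v]) <-> directed_cycle arc.
Proof.
split=> [zfs | cyc v]; last exact: directed_cycle_zero_forcing_set1.
have [V_le1 | V_gt1] := leqP #|V| 1.
  have V1 : #|V| = 1 by apply/eqP; rewrite eqn_leq V_le1.
  right; split=> // x y; have /fintype_le1P/(_ x y) -> := V_le1.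
  by rewrite arc_irr.
have out1 x := zero_forcing_set1_out arc_irr V_gt1 (zfs x).
(* The boolean form lets [xchoose] turn the unique out-neighbours into a function. *)
have out1b x : exists w, out_nbhd arc x == [set w].
  by have [w /eqP] := out1 x; exists w.
pose f x := xchoose (out1b x).
have outf x : out_nbhd arc x = [set f x] by apply/eqP/(xchooseP (out1b x)).
have /card_gt0P[v0 _] := V_nonempty.
apply: (@fconnect_full_directed_cycle _ _ f v0) => // x y.
  have [t Bt] := zfs x; have := zf_iter_orbit x t outf.
  by rewrite Bt => /subsetP/(_ y (in_setT y)); rewrite inE.
by have /setP/(_ y) := outf x; rewrite !inE.
Qed.
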